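(* Let $H_A,H_B$ be finite-dimensional Hilbert spaces and let $\Phi:B(H_A)\to B(H_B)$ be a positive, trace-preserving linear map whose adjoint $\Phi^*$ (with respect to the Hilbert–Schmidt inner product) satisfies the Schwarz-type inequality $$\Phi^{*}(\rho^{*})\,\Phi^{*}(\sigma)^{-1}\,\Phi^{*}(\rho)\le \Phi^{*}(\rho^{*}\sigma^{-1}\rho)$$ for every $\rho\in B(H_B)$ and every positive definite $\sigma\in B(H_B)$. Let $f:(0,\infty)\to\mathbb{R}$ be operator anti-monotone (i.e., $0<A\le B$ implies $f(A)\ge f(B)$ for positive definite matrices of every size). Then for all positive semidefinite $X,Y\in B(H_A)$, $$\tilde{Q}_{f}(X\|Y)\ge \tilde{Q}_{f}(\Phi(X)\|\Phi(Y)).$$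
   Context: Let $f:(0,\infty)\to\mathbb{R}$. For a finite-dimensional Hilbert space $H_S$, let $H_{\hat S}$ be an isomorphic copy, fix orthonormal bases $\{|i\rangle_S\}$, $\{|i\rangle_{\hat S}\}$, and set $|\Gamma\rangle_{S\hat S}=\sum_i |i\rangle_S|i\rangle_{\hat S}$. For positive semidefinite $X$ on $H_S$ let $|\phi^X\rangle_{S\hat S}=(X^{1/2}\otimes I_{\hat S})|\Gamma\rangle_{S\hat S}$. For positive definite $Z,\tau$ on $H_S$ define $$\tilde{Q}_f(X\|Z;\tau)=\langle\phi^X|\, f(\tau^{-1}\otimes Z^{T})\,|\phi^X\rangle,$$ where $Z^T$ is the transpose with respect to $\{|i\rangle_{\hat S}\}$. Equivalently, $\tilde{Q}_f(X\|Z;\tau)=\langle X^{1/2}, f(\Delta(Z,\tau))(X^{1/2})\rangle$, where $\Delta(Z,\tau)(W)=ZW\tau^{-1}$ on $B(H_S)$ with inner product $\langle A,B\rangle=\operatorname{tr}(A^*B)$. For positive semidefinite $X,Y$ on $H_S$, the optimized quantum $f$-divergence is $$\tilde{Q}_f(X\|Y)=\sup_{\tau>0,\ \operatorname{tr}(\tau)\le 1,\ \epsilon>0}\tilde{Q}_f(X\|Y+\epsilon\Pi_Y^{\perp};\tau),$$ where $\Pi_Y^\perp$ is the projection onto the kernel of $Y$. *)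

(* Defs.v *)
From HB Require Import structures.
From mathcomp Require Import all_boot all_order all_algebra.
From mathcomp Require Import complex mxtens.
From mathcomp Require Import boolp classical_sets reals constructive_ereal ereal.

Set Implicit Arguments.
Unset Strict Implicit.
Unset Printing Implicit Defensive.

Import Order.TTheory GRing.Theory Num.Theory.
Local Open Scope ring_scope.
Local Open Scope complex_scope.

Section QDefs.
Variable R : realType.
Local Notation C := R[i].

Definition adjmx {m n} (A : 'M[C]_(m, n)) : 'M[C]_(n, m) := (map_mx Num.conj A)^T.

Definition psdmx {n} (A : 'M[C]_n) : Prop :=
  adjmx A = A /\ forall v : 'cV[C]_n, 0 <= (adjmx v *m A *m v) 0 0.
Definition pdmx {n} (A : 'M[C]_n) : Prop :=
  adjmx A = A /\ forall v : 'cV[C]_n, v != 0 -> 0 < (adjmx v *m A *m v) 0 0.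

Definition loewner {n} (A B : 'M[C]_n) : Prop := psdmx (B - A).

Definition fcalc (g : R -> R) {n} (A : 'M[C]_n) : 'M[C]_n :=
  invmx (spectralmx A) *m
  diag_mx (map_mx (fun z : C => (g (complex.Re z))%:C) (spectral_diag A)) *m
  spectralmx A.

Definition op_anti_monotone (f : R -> R) : Prop :=
  forall (k : nat) (A B : 'M[C]_k), pdmx A -> loewner A B ->
    loewner (fcalc f B) (fcalc f A).

(* |Gamma> = sum_i |i>_S |i>_S^ in C^(n*n) (tensor index convention of mxtens) *)
Definition Gammavec n : 'cV[C]_(n * n) :=
  \col_k ((mxtens_unindex k).1 == (mxtens_unindex k).2)%:R.

Definition phivec {n} (X : 'M[C]_n) : 'cV[C]_(n * n) :=
  (fcalc Num.sqrt X *t (1%:M : 'M[C]_n)) *m Gammavec n.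

Definition Qtau (f : R -> R) {n} (X Z tau : 'M[C]_n) : R :=
  complex.Re ((adjmx (phivec X) *m fcalc f (invmx tau *t Z^T) *m phivec X) 0 0).

Definition kerproj {n} (Y : 'M[C]_n) : 'M[C]_n :=
  fcalc (fun x => if x == 0 then 1 else 0) Y.

Definition Qopt (f : R -> R) {n} (X Y : 'M[C]_n) : \bar R :=
  ereal_sup [set q : \bar R | exists (tau : 'M[C]_n) (eps : R),
     [/\ pdmx tau, \tr tau <= 1, 0 < eps &
         q = (Qtau f X (Y + eps%:C *: kerproj Y) tau)%:E]].

End QDefs.

(* Main.v *)
Require Import Defs.
From HB Require Import structures.
From mathcomp Require Import all_boot all_order all_algebra.
From mathcomp Require Import ring.
From mathcomp Require Import complex mxtens.
From mathcomp Require Import boolp classical_sets reals constructive_ereal ereal.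

(** Write [S = X^(1/2)], [B = Phi X] and let [G] be [B^(-1/2)] extended by the identity
    on [ker B]. By the Schwarz inequality at [sigma = 1], [V rho = S Phi^*(G rho)] is a
    contraction for the Hilbert-Schmidt norm; its adjoint is [V^* W = G Phi(S W)],
    so [V^* X^(1/2) = B^(1/2)], and since both vectors have the same norm,
    [V B^(1/2) = X^(1/2)].
    For [tau] on the output side take the Petz-type operator
    [tau_A ~ S Phi^*(G tau G) S + c]; the Schwarz inequality at [sigma = G tau G]
    gives [V^* Delta(Z, tau_A) V <= (1 + O(c)) Delta(Phi Z, tau)].
    Anti-monotonicity of [f] turns this into an inequality between the two
    quadratic forms, up to an error of weight [l] that vanishes as [l -> 0]. *)

Set Implicit Arguments.
Unset Strict Implicit.
Unset Printing Implicit Defensive.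

Import Order.TTheory GRing.Theory Num.Theory.
Local Open Scope ring_scope.

(** * Adjoints, Gram matrices and quadratic forms *)

Section Adjoint.
Variable R : realType.
Local Notation C := R[i].

Lemma adjmxK m n (A : 'M[C]_(m, n)) : adjmx (adjmx A) = A.
Proof. by apply/matrixP => i j; rewrite !mxE conjCK. Qed.

Lemma adjmxM m n p (A : 'M[C]_(m, n)) (B : 'M[C]_(n, p)) :
  adjmx (A *m B) = adjmx B *m adjmx A.
Proof. by rewrite /adjmx map_mxM trmx_mul. Qed.

Lemma adjmxD m n (A B : 'M[C]_(m, n)) : adjmx (A + B) = adjmx A + adjmx B.
Proof. by rewrite /adjmx map_mxD linearD. Qed.

Lemma adjmxN m n (A : 'M[C]_(m, n)) : adjmx (- A) = - adjmx A.
Proof. by rewrite /adjmx map_mxN linearN. Qed.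

Lemma adjmxB m n (A B : 'M[C]_(m, n)) : adjmx (A - B) = adjmx A - adjmx B.
Proof. by rewrite adjmxD adjmxN. Qed.

Lemma adjmxZ m n (c : C) (A : 'M[C]_(m, n)) : adjmx (c *: A) = c^* *: adjmx A.
Proof. by rewrite /adjmx map_mxZ linearZ. Qed.

Lemma adjmxZr m n (c : C) (A : 'M[C]_(m, n)) :
  c \is Num.real -> adjmx (c *: A) = c *: adjmx A.
Proof. by move=> /CrealP cE; rewrite adjmxZ; congr (_ *: _). Qed.

Lemma adjmx0 m n : adjmx (0 : 'M[C]_(m, n)) = 0.
Proof. by rewrite /adjmx map_mx0 trmx0. Qed.

Lemma adjmx1 n : adjmx (1%:M : 'M[C]_n) = 1%:M.
Proof. by rewrite /adjmx map_mx1 trmx1. Qed.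

Lemma adjmx_tr n (A : 'M[C]_n) : adjmx A^T = (adjmx A)^T.
Proof. by rewrite /adjmx -map_trmx. Qed.

Lemma mxtrace_adjmx n (A : 'M[C]_n) : \tr (adjmx A) = (\tr A)^*.
Proof. by rewrite /adjmx mxtrace_tr /mxtrace rmorph_sum; apply: eq_bigr => i _; rewrite mxE. Qed.

Lemma adjmx_tens m n p q (A : 'M[C]_(m, n)) (B : 'M[C]_(p, q)) :
  adjmx (A *t B) = adjmx A *t adjmx B.
Proof. by rewrite /adjmx map_mxT trmx_tens. Qed.

Lemma adjmx_col m1 m2 n (A : 'M[C]_(m1, n)) (B : 'M[C]_(m2, n)) :
  adjmx (col_mx A B) = row_mx (adjmx A) (adjmx B).
Proof. by rewrite /adjmx map_col_mx tr_col_mx. Qed.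

Lemma adjmx_block m1 m2 n1 n2 (A : 'M[C]_(m1, n1)) (B : 'M[C]_(m1, n2))
    (D : 'M[C]_(m2, n1)) (E : 'M[C]_(m2, n2)) :
  adjmx (block_mx A B D E) = block_mx (adjmx A) (adjmx D) (adjmx B) (adjmx E).
Proof. by rewrite /adjmx map_block_mx tr_block_mx. Qed.

Lemma adjmx_inv n (A : 'M[C]_n) : A \in unitmx -> adjmx (invmx A) = invmx (adjmx A).
Proof. by move=> uA; rewrite /adjmx map_invmx trmx_inv. Qed.

Lemma adjmx_spectral n (A : 'M[C]_n) : adjmx (spectralmx A) = invmx (spectralmx A).
Proof. by rewrite invmx_unitary ?spectral_unitarymx// /adjmx map_trmx. Qed.

Lemma gram_ge0 n (v : 'cV[C]_n) : 0 <= (adjmx v *m v) 0 0.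
Proof. by rewrite mxE sumr_ge0 // => i _; rewrite !mxE mulrC mul_conjC_ge0. Qed.

Lemma gram_eq0 n (v : 'cV[C]_n) : ((adjmx v *m v) 0 0 == 0) = (v == 0).
Proof.
apply/eqP/eqP => [h|->]; last by rewrite mulmx0 mxE.
apply/matrixP => i j; rewrite ord1 !mxE; apply/eqP; rewrite -mul_conjC_eq0; apply/eqP.
have /psumr_eq0P : \sum_i v i 0 * (v i 0)^* = 0.
  by rewrite -[RHS]h mxE; apply: eq_bigr => k _; rewrite !mxE mulrC.
by apply => // k _; exact: mul_conjC_ge0.
Qed.

Definition qform n (A : 'M[C]_n) (v : 'cV[C]_n) : C := (adjmx v *m A *m v) 0 0.

Lemma qform_congr m n (A : 'M[C]_m) (M : 'M[C]_(m, n)) v :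
  qform (adjmx M *m A *m M) v = qform A (M *m v).
Proof. by rewrite /qform adjmxM !mulmxA. Qed.

Lemma qformB n (A B : 'M[C]_n) v : qform (A - B) v = qform A v - qform B v.
Proof. by rewrite /qform mulmxBr mulmxBl !mxE. Qed.

Lemma qformZ n (c : C) (A : 'M[C]_n) v : qform (c *: A) v = c * qform A v.
Proof. by rewrite /qform -scalemxAr -scalemxAl mxE. Qed.

Lemma qform0 n (A : 'M[C]_n) : qform A 0 = 0.
Proof. by rewrite /qform mulmx0 mxE. Qed.

Lemma qform_scale n (A : 'M[C]_n) (c : C) v : qform A (c *: v) = c^* * c * qform A v.
Proof. by rewrite /qform adjmxZ -!scalemxAl -scalemxAr scalerA mxE. Qed.

Lemma qform_block m n (A : 'M[C]_m) (B : 'M[C]_n) u v :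
  qform (block_mx A 0 0 B) (col_mx u v) = qform A u + qform B v.
Proof.
rewrite /qform adjmx_col -mulmxA mul_block_col !mul0mx addr0 add0r.
by rewrite mul_row_col !mulmxA mxE.
Qed.

End Adjoint.

(** * Positive matrices and their eigenvalues *)

Section Psd.
Variable R : realType.
Local Notation C := R[i].

Lemma psdmx_herm n (A : 'M[C]_n) : psdmx A -> adjmx A = A. Proof. by case. Qed.

Lemma pdmx_psd n (A : 'M[C]_n) : pdmx A -> psdmx A.
Proof.
move=> [hA pA]; split=> // v; have [->|/pA/ltW//] := eqVneq v 0.
by rewrite mulmx0 mxE.
Qed.

Lemma psdmx_congr m n (A : 'M[C]_m) (M : 'M[C]_(m, n)) :
  psdmx A -> psdmx (adjmx M *m A *m M).
Proof.
move=> [hA pA]; split; first by rewrite !adjmxM adjmxK hA mulmxA.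
by move=> v; have := pA (M *m v); rewrite adjmxM !mulmxA.
Qed.

Lemma pdmx_congr m n (A : 'M[C]_m) (M : 'M[C]_(m, n)) :
  (forall v : 'cV_n, M *m v = 0 -> v = 0) -> pdmx A -> pdmx (adjmx M *m A *m M).
Proof.
move=> iM [hA pA]; split; first by rewrite !adjmxM adjmxK hA mulmxA.
move=> v v0; have := pA (M *m v); rewrite adjmxM !mulmxA; apply.
by apply: contra v0 => /eqP/iM ->.
Qed.

Lemma pdmx_congr_unit n (A M : 'M[C]_n) :
  M \in unitmx -> pdmx A -> pdmx (adjmx M *m A *m M).
Proof. by move=> uM; apply: pdmx_congr => v h; rewrite -(mulKmx uM v) h mulmx0. Qed.

Lemma psdmx1 n : psdmx (1%:M : 'M[C]_n).
Proof. by split=> [|v]; rewrite ?adjmx1 // mulmx1 gram_ge0. Qed.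

Lemma pdmx1 n : pdmx (1%:M : 'M[C]_n).
Proof. by split=> [|v v0]; rewrite ?adjmx1 // mulmx1 lt_def gram_eq0 v0 gram_ge0. Qed.

Lemma psdmx_gram m n (M : 'M[C]_(m, n)) : psdmx (adjmx M *m M).
Proof. by rewrite -[adjmx M]mulmx1; apply/psdmx_congr/psdmx1. Qed.

Lemma psdmxD n (A B : 'M[C]_n) : psdmx A -> psdmx B -> psdmx (A + B).
Proof.
move=> [hA pA] [hB pB]; split; first by rewrite adjmxD hA hB.
by move=> v; rewrite mulmxDr mulmxDl mxE addr_ge0.
Qed.

Lemma pdmxDl n (A B : 'M[C]_n) : pdmx A -> psdmx B -> pdmx (A + B).
Proof.
move=> [hA pA] [hB pB]; split; first by rewrite adjmxD hA hB.
by move=> v v0; rewrite mulmxDr mulmxDl mxE ltr_wpDr // pA.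
Qed.

Lemma psdmxZ n (c : C) (A : 'M[C]_n) : 0 <= c -> psdmx A -> psdmx (c *: A).
Proof.
move=> c0 [hA pA]; split; first by rewrite adjmxZr ?ger0_real// hA.
by move=> v; rewrite -scalemxAr -scalemxAl mxE mulr_ge0.
Qed.

Lemma pdmxZ n (c : C) (A : 'M[C]_n) : 0 < c -> pdmx A -> pdmx (c *: A).
Proof.
move=> c0 [hA pA]; split; first by rewrite adjmxZr ?gtr0_real// hA.
by move=> v v0; rewrite -scalemxAr -scalemxAl mxE mulr_gt0 ?pA.
Qed.

Lemma psdmx_block m n (A : 'M[C]_m) (B : 'M[C]_n) :
  psdmx A -> psdmx B -> psdmx (block_mx A 0 0 B).
Proof.
move=> [hA pA] [hB pB]; split; first by rewrite adjmx_block hA hB !adjmx0.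
move=> v; rewrite -[v]vsubmxK adjmx_col -mulmxA mul_block_col !mul0mx addr0 add0r.
by rewrite mul_row_col !mulmxA mxE addr_ge0.
Qed.

Lemma pdmx_block m n (A : 'M[C]_m) (B : 'M[C]_n) :
  pdmx A -> pdmx B -> pdmx (block_mx A 0 0 B).
Proof.
move=> pA pB; have [? p] := psdmx_block (pdmx_psd pA) (pdmx_psd pB).
split=> // v; rewrite -[v]vsubmxK adjmx_col -mulmxA mul_block_col !mul0mx addr0 add0r.
rewrite mul_row_col !mulmxA mxE.
have [->|u0 _] := eqVneq (usubmx v) 0.
  rewrite mulmx0 mxE add0r => v0; apply: pB.2.
  by apply: contra v0 => /eqP->; rewrite col_mx0.
by rewrite ltr_wpDr ?pA.2 ?(pdmx_psd pB).2.
Qed.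

Lemma spectral_decomp n (A : 'M[C]_n) : adjmx A = A ->
  A = invmx (spectralmx A) *m diag_mx (spectral_diag A) *m spectralmx A.
Proof.
move=> hA; apply/orthomx_spectralP/normalmxP.
by move: hA; rewrite /adjmx map_trmx => ->.
Qed.

Lemma psdmx_spectralP n (A : 'M[C]_n) (P : 'M[C]_n) (d : 'rV[C]_n) :
  P \in unitmx -> adjmx P = invmx P ->
  (forall i, 0 <= d 0 i) -> psdmx (invmx P *m diag_mx d *m P).
Proof.
move=> uP aP d0; rewrite -aP; apply: psdmx_congr; split.
  rewrite /adjmx map_diag_mx tr_diag_mx; congr diag_mx.
  by apply/matrixP => i j; rewrite ord1 mxE; apply/CrealP/ger0_real.
move=> v; rewrite -mulmxA mul_diag_mx mxE sumr_ge0 // => i _; rewrite !mxE.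
by rewrite mulrCA mulr_ge0 // mulrC mul_conjC_ge0.
Qed.

(** The columns of the inverse spectral matrix are eigenvectors of norm one, so sign conditions on
    the quadratic form pass to the eigenvalues. *)
Lemma spectral_diag_form n (A : 'M[C]_n) (i : 'I_n) : adjmx A = A ->
  let v := invmx (spectralmx A) *m delta_mx i (0 : 'I_1) in
  v != 0 /\ (adjmx v *m A *m v) 0 0 = spectral_diag A 0 i.
Proof.
move=> hA v; have uP := spectral_unit A; split.
  apply/eqP => /(congr1 (mulmx (spectralmx A))); rewrite mulKVmx // mulmx0.
  by move=> /matrixP/(_ i 0); rewrite !mxE !eqxx => /eqP; rewrite oner_eq0.
rewrite [A in _ *m A *m _]spectral_decomp // /v adjmxM -adjmx_spectral adjmxK !adjmx_spectral.
rewrite !mulmxA !mulmxK // -mulmxA mul_diag_mx mxE (bigD1 i) //= big1 ?addr0 => [|j ji];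
  rewrite !mxE ?eqxx.
  by rewrite conjC1 mul1r mulr1.
by rewrite (negPf ji) conjC0 mul0r.
Qed.

Lemma psdmx_diag_ge0 n (A : 'M[C]_n) i : psdmx A -> 0 <= spectral_diag A 0 i.
Proof. by move=> [hA pA]; have [_ <-] := spectral_diag_form i hA. Qed.

Lemma pdmx_diag_gt0 n (A : 'M[C]_n) i : pdmx A -> 0 < spectral_diag A 0 i.
Proof. by move=> [hA pA]; have [v0 <-] := spectral_diag_form i hA; exact: pA. Qed.

Lemma herm_diag_real n (A : 'M[C]_n) i : adjmx A = A -> spectral_diag A 0 i \is Num.real.
Proof.
move=> hA; have [_ <-] := spectral_diag_form i hA; move: (_ *m delta_mx i 0) => v.
have vAv : adjmx (adjmx v *m A *m v) = adjmx v *m A *m v.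
  by rewrite !adjmxM adjmxK hA mulmxA.
apply/CrealP; rewrite -[in RHS]vAv /adjmx [in RHS]mxE [in RHS]mxE //.
Qed.

Lemma herm_le_scalar n (A : 'M[C]_n) : adjmx A = A ->
  exists2 k : C, 0 < k & psdmx (k *: 1%:M - A).
Proof.
(* The sum of absolute values stands in for the maximum; the added 1 keeps the bound positive when
   all eigenvalues vanish. *)
move=> hA; pose s := \sum_i `|spectral_diag A 0 i|; exists (1 + s).
  by rewrite ltr_pwDl // sumr_ge0.
have uP := spectral_unit A.
rewrite [X in _ - X]spectral_decomp // -{1}(mulVmx uP) scalemxAl -mulmxBl.
rewrite -[X in X - _]mulmx1 -scalemxAl scalemxAr -mulmxBr -diag_const_mx.
rewrite -linearZ /= -linearB /=; apply: psdmx_spectralP => // [|i].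
  exact: adjmx_spectral.
rewrite !mxE mulr1 subr_ge0 (le_trans (real_ler_norm (herm_diag_real i hA))) //.
by rewrite ler_wpDl // /s (bigD1 i) //= lerDl sumr_ge0.
Qed.

Lemma pdmx_ge_scalar n (A : 'M[C]_n) : pdmx A ->
  exists2 k : C, 0 < k & psdmx (A - k *: 1%:M).
Proof.
(* The inverse of each eigenvalue is at most [1 + s], so [(1 + s)^-1] lies below the whole
   spectrum. *)
move=> pA; have hA := pA.1; pose s := \sum_i (spectral_diag A 0 i)^-1; exists (1 + s)^-1.
  by rewrite invr_gt0 ltr_pwDl // sumr_ge0 // => i _; rewrite invr_ge0 ltW ?pdmx_diag_gt0.
have uP := spectral_unit A.
rewrite [X in X - _]spectral_decomp // -{1}(mulVmx uP) scalemxAl -mulmxBl.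
rewrite -[X in _ - X]mulmx1 -scalemxAl scalemxAr -mulmxBr -diag_const_mx.
rewrite -linearZ /= -linearB /=; apply: psdmx_spectralP => // [|i].
  exact: adjmx_spectral.
have si j : 0 <= (spectral_diag A 0 j)^-1 by rewrite invr_ge0 ltW ?pdmx_diag_gt0.
have di := pdmx_diag_gt0 i pA.
rewrite !mxE mulr1 subr_ge0 -[leRHS]invrK lef_pV2 ?posrE ?invr_gt0 //.
  by rewrite ler_wpDl // /s (bigD1 i) //= lerDl sumr_ge0.
by rewrite ltr_pwDl // sumr_ge0.
Qed.

(** A nonzero column of the cokernel would be a null vector of the quadratic form. *)
Lemma pdmx_unit n (A : 'M[C]_n) : pdmx A -> A \in unitmx.
Proof.
move=> pA; rewrite -row_full_unit -cokermx_eq0; apply/eqP/matrixP => i j.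
have /(congr1 (col j)) := mulmx_coker A; rewrite colE -mulmxA -colE => h.
have [c0|/pA.2] := eqVneq (col j (cokermx A)) 0.
  by have /matrixP/(_ i 0) := c0; rewrite !mxE.
by rewrite -mulmxA h col0 mulmx0 mxE ltxx.
Qed.

End Psd.

(** * Functional calculus of hermitian matrices *)

Section Fcalc.
Variable R : realType.
Local Notation C := R[i].
Implicit Types g h : R -> R.

(* All the algebra of the functional calculus comes from this: in the two
   eigenbases, [A *m W = W *m B] says that the entries of [W] can be nonzero
   only where the eigenvalues of [A] and [B] agree. *)
Lemma fcalc_intertwine g m n (A : 'M[C]_m) (B : 'M[C]_n) (W : 'M[C]_(m, n)) :
  adjmx A = A -> adjmx B = B -> A *m W = W *m B -> fcalc g A *m W = W *m fcalc g B.
Proof.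
move=> hA hB; rewrite /fcalc {1}(spectral_decomp hA) {1}(spectral_decomp hB) => AW.
have uA := spectral_unit A; have uB := spectral_unit B.
move: (spectralmx A) (spectralmx B) (spectral_diag A) (spectral_diag B) uA uB AW.
move=> P Q d e uP uQ AW; pose W' := P *m W *m invmx Q.
have WE : W = invmx P *m W' *m Q by rewrite /W' !mulmxA mulVmx // mul1mx mulmxKV.
have dW : diag_mx d *m W' = W' *m diag_mx e.
  move: AW => /(congr1 (fun M => P *m M *m invmx Q)).
  by rewrite !mulmxA mulmxV // mul1mx mulmxK // /W' !mulmxA.
move: W' WE dW => W' -> dW; rewrite !mulmxA mulmxK // mulmxK // -!mulmxA.
congr (_ *m _); rewrite !mulmxA; congr (_ *m _).
apply/matrixP => i j; have /matrixP/(_ i j) := dW.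
rewrite !mul_diag_mx !mul_mx_diag !mxE => dWij.
have [->|w0] := eqVneq (W' i j) 0; first by rewrite mulr0 mul0r.
have /(mulfI w0) -> : W' i j * d 0 i = W' i j * e 0 j by rewrite -dWij mulrC.
exact: mulrC.
Qed.

Lemma fcalc_herm g n (A : 'M[C]_n) : adjmx (fcalc g A) = fcalc g A.
Proof.
rewrite /fcalc; move: (spectralmx A) (adjmx_spectral A) (spectral_diag A) => P <- d.
rewrite !adjmxM adjmxK mulmxA; set D := diag_mx _; suff -> : adjmx D = D by [].
rewrite /adjmx map_diag_mx tr_diag_mx; apply: (congr1 diag_mx).
apply/matrixP => i j; rewrite !mxE; exact: conjc_real.
Qed.

Lemma fcalcM g h n (A : 'M[C]_n) : fcalc g A *m fcalc h A = fcalc (fun x => g x * h x) A.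
Proof.
rewrite /fcalc; move: (spectralmx A) (spectral_unit A) (spectral_diag A) => P uP d.
have cM (D E : 'M[C]_n) :
    invmx P *m D *m P *m (invmx P *m E *m P) = invmx P *m (D *m E) *m P.
  by rewrite !mulmxA mulmxK.
rewrite cM mulmx_diag.
apply: (congr1 (fun e => invmx P *m diag_mx e *m P)).
by apply/matrixP => i j; rewrite !mxE ord1 rmorphM.
Qed.

Lemma fcalcD g h n (A : 'M[C]_n) : fcalc g A + fcalc h A = fcalc (fun x => g x + h x) A.
Proof.
rewrite /fcalc; move: (spectralmx A) (spectral_diag A) => P d.
rewrite -mulmxDl -mulmxDr -linearD; apply: (congr1 (fun e => invmx P *m diag_mx e *m P)).
by apply/matrixP => i j; rewrite !mxE ord1 rmorphD.
Qed.

Lemma eq_fcalc g h n (A : 'M[C]_n) :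
  (forall i, g (complex.Re (spectral_diag A 0 i)) = h (complex.Re (spectral_diag A 0 i))) ->
  fcalc g A = fcalc h A.
Proof.
rewrite /fcalc; move: (spectralmx A) (spectral_diag A) => P d gh.
apply: (congr1 (fun e => invmx P *m diag_mx e *m P)).
by apply/matrixP => i j; rewrite !mxE ord1 gh.
Qed.

Lemma fcalc_id n (A : 'M[C]_n) : adjmx A = A -> fcalc id A = A.
Proof.
move=> hA; have dR i := herm_diag_real i hA; rewrite [RHS](spectral_decomp hA) /fcalc.
move: (spectralmx A) (spectral_diag A) dR => P d dR.
apply: (congr1 (fun e => invmx P *m diag_mx e *m P)).
by apply/matrixP => i j; rewrite !mxE ord1 RRe_real.
Qed.

Lemma fcalc1 n (A : 'M[C]_n) : fcalc (fun=> 1) A = 1%:M.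
Proof.
rewrite /fcalc; move: (spectralmx A) (spectral_unit A) (spectral_diag A) => P uP d.
rewrite [map_mx _ _](_ : _ = const_mx 1); first by rewrite diag_const_mx mulmx1 mulVmx.
by apply/matrixP => i j; rewrite !mxE.
Qed.

Lemma Re_ge0 (z : C) : 0 <= z -> 0 <= complex.Re z.
Proof. by rewrite lecE => /andP[]. Qed.

Lemma Re_gt0 (z : C) : 0 < z -> 0 < complex.Re z.
Proof. by rewrite ltcE => /andP[]. Qed.

Lemma fcalc_psd g n (A : 'M[C]_n) : psdmx A ->
  (forall x, 0 <= x -> 0 <= g x) -> psdmx (fcalc g A).
Proof.
move=> pA g0; apply: psdmx_spectralP (adjmx_spectral A) _ => //; first exact: spectral_unit.
by move=> i; rewrite !mxE ler0c g0 // Re_ge0 ?psdmx_diag_ge0.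
Qed.

Lemma sqrtmxK n (A : 'M[C]_n) : psdmx A ->
  fcalc Num.sqrt A *m fcalc Num.sqrt A = A.
Proof.
move=> pA; rewrite fcalcM -[RHS](fcalc_id pA.1); apply: eq_fcalc => i.
by rewrite -expr2 sqr_sqrtr // Re_ge0 ?psdmx_diag_ge0.
Qed.

End Fcalc.

(** * Block matrices, contractions and the Jensen-type inequality *)

Section Jensen.
Variable R : realType.
Local Notation C := R[i].

(** The eigenbasis chosen for the block matrix need not respect the blocks; intertwining with the
    two coordinate inclusions avoids any comparison of eigenbases. *)
Lemma fcalc_block (g : R -> R) m n (A : 'M[C]_m) (B : 'M[C]_n) :
  adjmx A = A -> adjmx B = B ->
  fcalc g (block_mx A 0 0 B) = block_mx (fcalc g A) 0 0 (fcalc g B).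
Proof.
move=> hA hB; have hAB : adjmx (block_mx A 0 0 B) = block_mx A 0 0 B.
  by rewrite adjmx_block hA hB !adjmx0.
have hl : fcalc g (block_mx A 0 0 B) *m col_mx 1%:M 0 = col_mx 1%:M 0 *m fcalc g A.
  apply: fcalc_intertwine => //.
  by rewrite mul_block_col mul_col_mx !mulmx1 !mulmx0 !mul0mx mul1mx !addr0.
have hr : fcalc g (block_mx A 0 0 B) *m col_mx 0 1%:M = col_mx 0 1%:M *m fcalc g B.
  apply: fcalc_intertwine => //.
  by rewrite mul_block_col mul_col_mx !mulmx1 !mulmx0 !mul0mx mul1mx !add0r.
rewrite -[LHS]mulmx1 scalar_mx_block [block_mx 1%:M _ _ _]block_mxEh mul_mx_row hl hr.
by rewrite !mul_col_mx !mul1mx !mul0mx -block_mxEh.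
Qed.

(** With [W] the adjoint of [V], [1 - V W = (1 - V W)^2 + V (1 - W V) W], a sum of two positive
    terms. *)
Lemma psdmx_1sub_gram_adj m n (V : 'M[C]_(m, n)) :
  psdmx (1%:M - adjmx V *m V) -> psdmx (1%:M - V *m adjmx V).
Proof.
move=> pV; have := psdmxD (psdmx_gram (1%:M - V *m adjmx V)) (psdmx_congr (adjmx V) pV).
rewrite adjmxK adjmxB adjmx1 adjmxM adjmxK; congr psdmx.
rewrite !mulmxBr !mulmxBl !mulmx1 !mul1mx !mulmxA.
by rewrite subrK.
Qed.

(** Since [<w, V u> = |u|^2 = |w|^2], expanding gives [|V u - w|^2 = |V u|^2 - |u|^2], which is at
    most 0 for a contraction. *)
Lemma contraction_attained m n (V : 'M[C]_(m, n)) (u : 'cV[C]_n) (w : 'cV[C]_m) :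
  psdmx (1%:M - adjmx V *m V) -> adjmx V *m w = u ->
  adjmx u *m u = adjmx w *m w -> V *m u = w.
Proof.
move=> pV Vw uw; apply/eqP; rewrite -subr_eq0 -gram_eq0; apply/eqP/le_anti.
rewrite gram_ge0 andbT -oppr_ge0.
have wV : adjmx w *m V = adjmx u by rewrite -Vw adjmxM adjmxK.
have := pV.2 u; congr (0 <= _).
rewrite adjmxB adjmxM !mulmxBr !mulmxBl mulmx1 -!mulmxA Vw !mulmxA wV -uw !mxE.
by ring.
Qed.

(** The off-diagonal block [B] of [Z] is absorbed by the positive matrix [t^-1 M^* M] with
    [M = (t, -B)]: it costs [t] in the first corner and [t^-1 B^* B] in the second, where [K] may be
    as large as needed. *)
Lemma block_dominate p q (Z : 'M[C]_(p + q)) (E : 'M[C]_p) (t : C) :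
  adjmx Z = Z -> 0 < t -> psdmx (E - ulsubmx Z - t *: 1%:M) ->
  exists2 K : C, 0 < K & psdmx (block_mx E 0 0 (K *: 1%:M) - Z).
Proof.
move=> hZ t0 pE; have t'0 : 0 <= t^-1 by rewrite invr_ge0 ltW.
set Z11 := ulsubmx Z in pE *; pose B := ursubmx Z; pose Z22 := drsubmx Z.
have ZE : Z = block_mx Z11 B (adjmx B) Z22.
  have : dlsubmx (adjmx Z) = adjmx B by apply/matrixP => i j; rewrite !mxE.
  by rewrite hZ => <-; exact/esym/submxK.
have hZ22 : adjmx Z22 = Z22.
  have : drsubmx (adjmx Z) = adjmx Z22 by apply/matrixP => i j; rewrite !mxE.
  by rewrite hZ.
have [k1 k10 pk1] := herm_le_scalar hZ22.
have [k2 k20 pk2] := herm_le_scalar (psdmx_herm (psdmxZ t'0 (psdmx_gram B))).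
exists (k1 + k2); first exact: addr_gt0.
have := psdmxZ t'0 (psdmx_gram (row_mx (t *: 1%:M) (- B))).
rewrite [adjmx (row_mx _ _)](_ : _ = col_mx (t *: 1%:M) (- adjmx B)); last first.
  rewrite -adjmxN -[t *: 1%:M in RHS]adjmxK -{2}[B]opprK.
  by rewrite -[LHS]adjmxK -[RHS]adjmxK; congr adjmx; rewrite adjmxK adjmx_col
     !adjmxK adjmxZr ?adjmx1 ?gtr0_real // opprK.
rewrite mul_col_row scale_block_mx => /(psdmxD (psdmx_block pE (psdmxD pk1 pk2))).
congr psdmx; rewrite ZE opp_block_mx !add_block_mx !add0r.
congr block_mx.
- rewrite -scalemxAl -scalemxAr !mulmx1 !scalerA mulVf ?gt_eqF // mul1r.
  by rewrite subrK.
- by rewrite -scalemxAl mul1mx !scalerN scalerA mulVf ?gt_eqF // scale1r.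
- by rewrite -scalemxAr mulmx1 !scalerN scalerA mulVf ?gt_eqF // scale1r.
- by rewrite mulNmx mulmxN opprK -addrA subrK addrAC -scalerDl.
Qed.

(* Hansen's trick: the Halmos dilation [U] of the contraction [V] is unitary, and
   [U^* (D (+) s/2) U] is dominated by a block diagonal [E (+) K] once [K] is large,
   so that a single use of anti-monotonicity replaces the operator Jensen inequality. *)
Lemma anti_monotone_contraction (f : R -> R) p q (V : 'M[C]_(q, p)) (D : 'M[C]_q)
    (E : 'M[C]_p) (s : C) (u : 'cV[C]_p) (w : 'cV[C]_q) :
  op_anti_monotone f -> pdmx D -> adjmx E = E -> 0 < s ->
  psdmx (1%:M - adjmx V *m V) -> psdmx (E - adjmx V *m D *m V - s *: 1%:M) ->
  adjmx V *m w = u -> adjmx u *m u = adjmx w *m w ->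
  qform (fcalc f E) u <= qform (fcalc f D) w.
Proof.
move=> f_anti pD hE s0 pV pE Vw uw; have Vu := contraction_attained pV Vw uw.
have pV' := psdmx_1sub_gram_adj pV.
set P1 := 1%:M - adjmx V *m V in pV; set P2 := 1%:M - V *m adjmx V in pV'.
pose D1 := fcalc Num.sqrt P1; pose D2 := fcalc Num.sqrt P2.
have hD1 : adjmx D1 = D1 := fcalc_herm _ _.
have hD2 : adjmx D2 = D2 := fcalc_herm _ _.
have D1D1 : D1 *m D1 = 1%:M - adjmx V *m V by rewrite sqrtmxK.
have D2D2 : D2 *m D2 = 1%:M - V *m adjmx V by rewrite sqrtmxK.
(* [V] intertwines [P1] and [P2], hence also their square roots. *)
have D2V : D2 *m V = V *m D1.
  apply: (fcalc_intertwine _ pV'.1 pV.1).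
  by rewrite /P1 /P2 mulmxBl mulmxBr mul1mx mulmx1 !mulmxA.
have VD2 : adjmx V *m D2 = D1 *m adjmx V by rewrite -hD2 -adjmxM D2V adjmxM hD1.
(* [V^* V] fixes [u], so [D1^2] kills it. *)
have D1u : D1 *m u = 0.
  apply/eqP; rewrite -gram_eq0 adjmxM hD1 mulmxA -(mulmxA _ D1 D1) D1D1 mulmxBr mulmxBl.
  by rewrite mulmx1 !mulmxA -(mulmxA _ V) Vu -(mulmxA _ _ w) Vw subrr mxE.
pose U := block_mx V D2 D1 (- adjmx V).
have Uadj : adjmx U = block_mx (adjmx V) D1 D2 (- V).
  by rewrite adjmx_block adjmxN adjmxK hD1 hD2.
have UU : adjmx U *m U = 1%:M.
  rewrite Uadj /U mulmx_block D1D1 D2D2 !mulmxN !mulNmx !opprK VD2 D2V.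
  by rewrite !subrr ?[V *m _ + _]addrC ?[adjmx V *m _ + _]addrC !subrK -scalar_mx_block.
have UU' : U *m adjmx U = 1%:M.
  rewrite Uadj /U mulmx_block D1D1 D2D2 !mulmxN !mulNmx !opprK VD2 D2V.
  by rewrite !subrr ?[V *m _ + _]addrC ?[adjmx V *m _ + _]addrC !subrK -scalar_mx_block.
have s2 : 0 < s / 2 by rewrite divr_gt0.
(* The filler has to be positive definite for anti-monotonicity to apply. In the first corner it
   adds [(s / 2) D1^2 <= s / 2], which leaves half of the gap [s] for [block_dominate]. *)
pose A' := block_mx D 0 0 ((s / 2) *: 1%:M : 'M[C]_p).
have pA' : pdmx A' by apply: pdmx_block => //; apply: pdmxZ (pdmx1 _ _).
pose Z := adjmx U *m A' *m U.
have pZ : pdmx Z.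
  by apply: pdmx_congr => // v Uv; rewrite -[v]mul1mx -UU -mulmxA Uv mulmx0.
have pEZ : psdmx (E - ulsubmx Z - (s / 2) *: 1%:M).
  have -> : ulsubmx Z = adjmx V *m D *m V + (s / 2) *: (D1 *m D1).
    rewrite /Z Uadj /A' /U !mulmx_block block_mxKul !mulmx0 !addr0 add0r.
    by rewrite -scalemxAr mulmx1 -scalemxAl.
  have := psdmxD pE (psdmxZ (ltW s2) (psdmx_gram V)); congr psdmx.
  by rewrite D1D1; apply/matrixP => i j; rewrite !mxE; field.
have [K K0 pK] := block_dominate pZ.1 s2 pEZ.
have := (f_anti _ _ _ pZ pK).2 (col_mx u 0).
have fZ : fcalc f Z = adjmx U *m fcalc f A' *m U.
  rewrite -mulmxA (fcalc_intertwine f pA'.1 pZ.1) ?mulmxA ?UU ?mul1mx //.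
  by rewrite /Z ?mulmxA UU' mul1mx.
(* The second component is [D1 u = 0], so the filler and [K] drop out of the two forms. *)
have Ux : U *m col_mx u 0 = col_mx w 0.
  by rewrite /U mul_block_col !mulmx0 !addr0 Vu D1u.
rewrite -/(qform _ _) qformB subr_ge0 fZ qform_congr Ux.
have hs n (c : C) : 0 < c -> adjmx (c *: 1%:M : 'M[C]_n) = c *: 1%:M.
  by move=> c0; rewrite adjmxZr ?gtr0_real // adjmx1.
by rewrite !fcalc_block ?pD.1 ?hs // !qform_block !qform0 !addr0.
Qed.

(* The extra summand [E / 2], with weight [l], opens the gap that the strict
   hypothesis of [anti_monotone_contraction] needs; it makes the continuity of [f]
   unnecessary. *)
Lemma anti_monotone_contraction_slack (f : R -> R) p q (V : 'M[C]_(q, p)) (D : 'M[C]_q)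
    (E : 'M[C]_p) (l : C) (u : 'cV[C]_p) (w : 'cV[C]_q) :
  op_anti_monotone f -> pdmx D -> pdmx E -> 0 < l -> l < 1 ->
  psdmx (1%:M - adjmx V *m V) -> psdmx ((1 + l / 4) *: E - adjmx V *m D *m V) ->
  adjmx V *m w = u -> adjmx u *m u = adjmx w *m w ->
  qform (fcalc f E) u <=
  (1 - l) * qform (fcalc f D) w + l * qform (fcalc f (2^-1 *: E)) u.
Proof.
move=> f_anti pD pE l0 l1 pV pVD Vw uw.
have [k k0 pk] := pdmx_ge_scalar pE.
have pE2 : pdmx (2^-1 *: E) by apply: pdmxZ => //; rewrite invr_gt0.
have l1' : 0 <= 1 - l by rewrite subr_ge0 ltW.
(* With square-root weights [V'] is again a contraction, its adjoint still sends [w'] to [u], and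
   the form of [f(D')] at [w'] is the weighted sum on the right. *)
pose a := sqrtC (1 - l); pose b := sqrtC l.
have a0 : 0 <= a by rewrite sqrtC_ge0.
have b0 : 0 <= b by rewrite sqrtC_ge0 ltW.
have aa : a * a = 1 - l by rewrite -expr2 sqrtCK.
have bb : b * b = l by rewrite -expr2 sqrtCK.
pose V' := col_mx (a *: V) (b *: 1%:M).
pose w' := col_mx (a *: w) (b *: u).
have aV' : adjmx V' = row_mx (a *: adjmx V) (b *: 1%:M).
  by rewrite adjmx_col (adjmxZr V (ger0_real a0)) (adjmxZr _ (ger0_real b0)) adjmx1.
have aw' : adjmx w' = row_mx (a *: adjmx w) (b *: adjmx u).
  by rewrite adjmx_col (adjmxZr w (ger0_real a0)) (adjmxZr u (ger0_real b0)).
pose D' := block_mx D 0 0 (2^-1 *: E).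
have pD' : pdmx D' by apply: pdmx_block.
(* The available multiple of [E] is [1 - (1 - l)(1 + l/4) - l/2 = l/4 + l^2/4]; by [E >= k] its
   [l/4] part yields the gap [l k / 4]. *)
have s0 : 0 < l * k / 4 by rewrite divr_gt0 ?mulr_gt0.
have wE : (1 - l) * qform (fcalc f D) w + l * qform (fcalc f (2^-1 *: E)) u =
          qform (fcalc f D') w'.
  rewrite /D' fcalc_block ?pD.1 ?pE2.1 // qform_block !qform_scale.
  by rewrite !geC0_conj // aa bb.
rewrite wE; apply: (anti_monotone_contraction (V := V') f_anti pD' pE.1 s0).
- have := psdmxZ l1' pV; congr psdmx.
  rewrite aV' mul_row_col -!scalemxAl -!scalemxAr !scalerA aa bb mulmx1.
  by apply/matrixP => i j; rewrite !mxE; ring.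
- have i4 : 0 <= 4^-1 :> C by rewrite invr_ge0.
  have := psdmxD (psdmxZ l1' pVD) (psdmxD
    (psdmxZ (mulr_ge0 (mulr_ge0 (ltW l0) (ltW l0)) i4) (pdmx_psd pE))
    (psdmxZ (mulr_ge0 (ltW l0) i4) pk)).
  congr psdmx; rewrite aV' /D' mul_row_block !mulmx0 addr0 add0r mul_row_col.
  rewrite -!scalemxAl -!scalemxAr !mul1mx !mulmx1 !scalerA aa mulrA bb.
  by apply/matrixP => i j; rewrite !mxE; field.
- by rewrite aV' mul_row_col -!scalemxAl -!scalemxAr mul1mx !scalerA aa bb Vw -scalerDl subrK scale1r.
- by rewrite aw' mul_row_col -!scalemxAl -!scalemxAr !scalerA aa bb -uw -scalerDl subrK scale1r.
Qed.

End Jensen.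

(** * Trace forms, vectorization and regularized inverses *)

Section TraceForms.
Variable R : realType.
Local Notation C := R[i].

Lemma psdmx_trace_ge0 n (A : 'M[C]_n) : psdmx A -> 0 <= \tr A.
Proof.
move=> [_ pA]; rewrite sumr_ge0 // => i _; have := pA (delta_mx i 0).
have -> : adjmx (delta_mx i 0 : 'cV[C]_n) = delta_mx 0 i.
  by apply/matrixP => j k; rewrite !mxE rmorph_nat andbC.
by rewrite -rowE -colE !mxE.
Qed.

Lemma psdmx_trace_mul_ge0 n (A B : 'M[C]_n) : psdmx A -> psdmx B -> 0 <= \tr (A *m B).
Proof.
move=> pA pB; have hM := fcalc_herm Num.sqrt B; have MM := sqrtmxK pB.
move: (fcalc _ _) hM MM => M hM MM.
rewrite -MM mulmxA mxtrace_mulC mulmxA -{1}hM; exact/psdmx_trace_ge0/psdmx_congr.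
Qed.

Lemma loewner_trace_mul n (A B Z : 'M[C]_n) : loewner A B -> psdmx Z ->
  \tr (A *m Z) <= \tr (B *m Z).
Proof. by move=> AB pZ; rewrite -subr_ge0 -linearB -mulmxBl; exact: psdmx_trace_mul_ge0. Qed.

Lemma trace_gram_eq0 m n (M : 'M[C]_(m, n)) : (\tr (adjmx M *m M) == 0) = (M == 0).
Proof.
apply/eqP/eqP => [tM|->]; last by rewrite mulmx0 linear0.
have gE k : (adjmx M *m M) k k = (adjmx (col k M) *m col k M) 0 0.
  by rewrite !mxE; apply: eq_bigr => a _; rewrite !mxE.
apply/matrixP => i j; have /psumr_eq0P h := tM.
have /eqP : (adjmx M *m M) j j = 0 by apply: h => // k _; rewrite gE gram_ge0.
by rewrite gE gram_eq0 => /eqP/matrixP/(_ i 0); rewrite !mxE.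
Qed.

Lemma trace_adj_inj m n (A B : 'M[C]_(m, n)) :
  (forall W, \tr (adjmx W *m A) = \tr (adjmx W *m B)) -> A = B.
Proof.
move=> AB; apply/eqP; rewrite -subr_eq0 -trace_gram_eq0 mulmxBr [\tr (_ - _)]linearB /= AB.
by rewrite subrr.
Qed.

(** With this indexing the Hilbert-Schmidt product becomes the standard one and [A *t B^T] acts as
    [W] to [A W B], which accounts for the transpose in [Qtau]. *)
Definition vecm n (W : 'M[C]_n) : 'cV[C]_(n * n) :=
  \col_k W (mxtens_unindex k).1 (mxtens_unindex k).2.

Definition unvecm n (v : 'cV[C]_(n * n)) : 'M[C]_n :=
  \matrix_(i, j) v (mxtens_index (i, j)) 0.

Lemma unvecmK n : cancel (@unvecm n) (@vecm n).
Proof.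
move=> v; apply/matrixP => k j; rewrite ord1 !mxE.
by rewrite -[k in RHS]mxtens_unindexK; case: (mxtens_unindex k).
Qed.

Lemma sum_tens n m (F : 'I_n -> 'I_m -> C) :
  \sum_(k < n * m) F (mxtens_unindex k).1 (mxtens_unindex k).2 = \sum_i \sum_j F i j.
Proof.
rewrite pair_bigA (reindex (@mxtens_index n m)).
  by apply: eq_bigr => [[i j] _]; rewrite mxtens_indexK.
by exists (@mxtens_unindex n m) => k _; rewrite ?mxtens_indexK ?mxtens_unindexK.
Qed.

Lemma tens_vecm n (A B W : 'M[C]_n) : (A *t B^T) *m vecm W = vecm (A *m W *m B).
Proof.
apply/matrixP => k j; rewrite !mxE /=.
under eq_bigr do rewrite !mxE.
rewrite (sum_tens (fun a b => A (mxtens_unindex k).1 a * B b (mxtens_unindex k).2 * W a b)).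
rewrite exchange_big /=; apply: eq_bigr => b _; rewrite mxE mulr_suml.
by apply: eq_bigr => a _; rewrite mulrAC.
Qed.

Lemma vecm_dot n (A B : 'M[C]_n) : (adjmx (vecm A) *m vecm B) 0 0 = \tr (adjmx A *m B).
Proof.
rewrite !mxE; under eq_bigr do rewrite !mxE.
rewrite (sum_tens (fun a b => (A a b)^* * B a b)) exchange_big /=.
by apply: eq_bigr => b _; rewrite !mxE; apply: eq_bigr => a _; rewrite !mxE.
Qed.

Lemma qform_tens n (A B W : 'M[C]_n) :
  qform (A *t B^T) (vecm W) = \tr (adjmx W *m A *m W *m B).
Proof. by rewrite /qform -mulmxA tens_vecm vecm_dot !mulmxA. Qed.

Lemma phivecE n (X : 'M[C]_n) : phivec X = vecm (fcalc Num.sqrt X).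
Proof.
rewrite /phivec; have -> : Gammavec R n = vecm 1%:M by apply/matrixP => k j; rewrite !mxE.
by rewrite -{1}trmx1 tens_vecm !mulmx1.
Qed.

Lemma vecm0 n : vecm (0 : 'M[C]_n) = 0.
Proof. by apply/matrixP => k j; rewrite !mxE. Qed.

(** On vectorizations the Hilbert-Schmidt adjoint becomes [adjmx], so the contraction lemmas for
    matrices apply to maps between matrix spaces. *)
Lemma super_mx m n (L : {linear 'M[C]_m -> 'M[C]_n}) :
  exists T : 'M[C]_(n * n, m * m), forall W, T *m vecm W = vecm (L W).
Proof.
exists (\matrix_(k, l) vecm (L (delta_mx (mxtens_unindex l).1 (mxtens_unindex l).2)) k 0).
move=> W; apply/matrixP => k j; rewrite ord1 mxE.
under eq_bigr do rewrite !mxE.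
rewrite (sum_tens (fun a b => L (delta_mx a b) (mxtens_unindex k).1 (mxtens_unindex k).2 * W a b)).
rewrite {2}[W]matrix_sum_delta mxE linear_sum summxE; apply: eq_bigr => a _.
rewrite linear_sum summxE; apply: eq_bigr => b _.
by rewrite linearZ mxE mulrC.
Qed.

Lemma pdmx_inv n (A : 'M[C]_n) : pdmx A -> pdmx (invmx A).
Proof.
move=> pA; have uA := pdmx_unit pA.
have := pdmx_congr_unit (M := invmx A) _ pA; rewrite unitmx_inv => /(_ uA).
by rewrite (adjmx_inv uA) pA.1 (mulVmx uA) mul1mx.
Qed.

Lemma pdmx_trace_congr_gt0 m n (A : 'M[C]_m) (W : 'M[C]_(m, n)) :
  pdmx A -> W != 0 -> 0 < \tr (adjmx W *m A *m W).
Proof.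
move=> pA W0; have [k k0 pk] := pdmx_ge_scalar pA.
have := psdmx_trace_ge0 (psdmx_congr W pk).
rewrite mulmxBr mulmxBl linearB subr_ge0; apply: lt_le_trans.
rewrite -scalemxAr mulmx1 -scalemxAl linearZ mulr_gt0 // lt_def psdmx_trace_ge0 ?andbT.
  by rewrite trace_gram_eq0.
exact: psdmx_gram.
Qed.

(** With [M] the square root of [B], the form at [vecm W] is [tr ((W M)^* A (W M))], and [W M]
    vanishes only if [W] does. *)
Lemma pdmx_tens n (A B : 'M[C]_n) : pdmx A -> pdmx B -> pdmx (A *t B^T).
Proof.
move=> pA pB; split; first by rewrite adjmx_tens adjmx_tr pA.1 pB.1.
move=> v; rewrite -[v]unvecmK; move: (unvecm v) => W W0; rewrite -/(qform _ _) qform_tens.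
have hM := fcalc_herm Num.sqrt B; have MM := sqrtmxK (pdmx_psd pB).
have uB := pdmx_unit pB; move: (fcalc _ _) hM MM uB => M hM <-.
rewrite unitmx_mul andbb => uM.
have -> : \tr (adjmx W *m A *m W *m (M *m M)) = \tr (adjmx (W *m M) *m A *m (W *m M)).
  by rewrite adjmxM hM mulmxA [LHS]mxtrace_mulC !mulmxA.
apply: pdmx_trace_congr_gt0 => //; apply: contra W0 => /eqP WM.
by rewrite -(mulmxK uM W) WM mul0mx vecm0.
Qed.

Lemma fcalc_pd g n (A : 'M[C]_n) : psdmx A -> (forall x, 0 <= x -> 0 < g x) ->
  pdmx (fcalc g A).
Proof.
move=> pA g0; pose h x := Num.sqrt (g x).
have re i : 0 <= complex.Re (spectral_diag A 0 i) by exact/Re_ge0/psdmx_diag_ge0.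
have -> : fcalc g A = adjmx (fcalc h A) *m 1%:M *m fcalc h A.
  rewrite mulmx1 fcalc_herm fcalcM; apply: eq_fcalc => i.
  by rewrite -expr2 sqr_sqrtr // ltW // g0.
apply: pdmx_congr_unit (pdmx1 _ _).
have hV : fcalc h A *m fcalc (fun x => (h x)^-1) A = 1%:M.
  rewrite fcalcM -(fcalc1 A); apply: eq_fcalc => i.
  by rewrite mulfV // gt_eqF // sqrtr_gt0 g0.
exact: (mulmx1_unit hV).1.
Qed.

Lemma fcalcZ (c : R) g n (A : 'M[C]_n) : c%:C%C *: fcalc g A = fcalc (fun x => c * g x) A.
Proof.
rewrite /fcalc; move: (spectralmx A) (spectral_diag A) => P d.
rewrite scalemxAl scalemxAr -linearZ; apply: (congr1 (fun e => invmx P *m diag_mx e *m P)).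
by apply/matrixP => i j; rewrite !mxE -rmorphM.
Qed.

Lemma kerproj_psd n (Y : 'M[C]_n) : psdmx Y -> psdmx (kerproj Y).
Proof. by move=> pY; apply: fcalc_psd => // x _; case: ifP. Qed.

Lemma pdmx_add_kerproj n (Y : 'M[C]_n) (e : R) : psdmx Y -> 0 < e ->
  pdmx (Y + e%:C%C *: kerproj Y).
Proof.
move=> pY e0; rewrite -{1}(fcalc_id pY.1) fcalcZ fcalcD; apply: fcalc_pd => // x x0.
by case: eqVneq => [->|xn0]; rewrite ?add0r ?mulr1 // mulr0 addr0 lt_def xn0.
Qed.

(** The value 1 of [g] at eigenvalue 0 keeps [G] invertible, so that [G tau G] is positive definite
    and can serve as [sigma]; [G B G] is still the projection onto the range of [B]. *)
Lemma sqrt_pinv_exists n (B : 'M[C]_n) : psdmx B ->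
  exists G, [/\ adjmx G = G, G \in unitmx, G *m B = fcalc Num.sqrt B &
    psdmx (1%:M - G *m B *m G)].
Proof.
move=> pB; pose g x : R := if Num.sqrt x == 0 then 1 else (Num.sqrt x)^-1.
have re i : 0 <= complex.Re (spectral_diag B 0 i) by exact/Re_ge0/psdmx_diag_ge0.
have GB : fcalc g B *m B = fcalc Num.sqrt B.
  rewrite -{2}(fcalc_id pB.1) fcalcM; apply: eq_fcalc => i; rewrite /g.
  move: (complex.Re _) (re i) => x x0.
  have [s0|s0] := eqVneq (Num.sqrt x) 0.
    by rewrite mul1r -{1}(sqr_sqrtr x0) s0 expr0n.
  by rewrite -{2}(sqr_sqrtr x0) expr2 mulKf.
exists (fcalc g B); split; [exact: fcalc_herm | | exact: GB | ].
  have gV : fcalc g B *m fcalc (fun x => (g x)^-1) B = 1%:M.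
    rewrite fcalcM -(fcalc1 B); apply: eq_fcalc => i.
    by rewrite mulfV // /g; case: ifP => [_|/negbT s0]; rewrite ?oner_eq0 ?invr_eq0.
  exact: (mulmx1_unit gV).1.
rewrite GB fcalcM -(fcalc1 B) -scaleN1r.
have -> : -1 = (-1 : R)%:C%C by rewrite rmorphN1.
rewrite fcalcZ fcalcD; apply: fcalc_psd => // x _; rewrite /g.
by case: eqVneq => [->|s0]; rewrite ?mul0r ?mulr0 ?addr0 ?mulfV ?mulr1 ?subrr.
Qed.

(* If [T >= S K S] then [W := S T^-1 S] satisfies [W K W <= W], and expanding
   [(K^-1 - W) K (K^-1 - W) >= 0] turns this into [W <= K^-1]. *)
Lemma loewner_compress_inv n (S K T : 'M[C]_n) : adjmx S = S -> pdmx K -> pdmx T ->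
  loewner (S *m K *m S) T -> loewner (S *m invmx T *m S) (invmx K).
Proof.
move=> hS pK pT KT; have uT := pdmx_unit pT; have uK := pdmx_unit pK.
have hT' := (pdmx_inv pT).1; have hK' := (pdmx_inv pK).1.
have TT := mulVmx uT; have KK := mulVmx uK; have KK' := mulmxV uK.
move: (invmx T) (invmx K) hT' hK' TT KK KK' => T' K' hT' hK' TT KK KK'.
have p1 := psdmx_congr (T' *m S) KT.
have E1 : adjmx (T' *m S) *m (T - S *m K *m S) *m (T' *m S) =
    S *m T' *m S - (S *m T' *m S) *m K *m (S *m T' *m S).
  by rewrite adjmxM hT' hS mulmxBr mulmxBl -(mulmxA S T' T) TT mulmx1 !mulmxA.
rewrite E1 in p1; have hW : adjmx (S *m T' *m S) = S *m T' *m S.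
  by rewrite !adjmxM hT' hS mulmxA.
move: (S *m T' *m S) hW p1 => W hW p1.
have := psdmxD p1 (psdmx_congr (K' - W) (pdmx_psd pK)).
rewrite adjmxB hK' hW /loewner; congr psdmx.
rewrite (mulmxBl K' W K) KK mulmxBr !mulmxBl !mul1mx -(mulmxA W K K') KK' mulmx1.
by apply/matrixP => i j; rewrite !mxE; ring.
Qed.

End TraceForms.

(** * Schwarz-type maps and the recovery contraction *)

Section SchwarzMap.
Variables (R : realType) (mA mB : nat).
Variables (Phi : {linear 'M[R[i]]_mA -> 'M[R[i]]_mB}) (Phistar : 'M[R[i]]_mB -> 'M[R[i]]_mA).
Hypothesis Phi_pos : forall X : 'M[R[i]]_mA, psdmx X -> psdmx (Phi X).
Hypothesis Phi_tp : forall X : 'M[R[i]]_mA, \tr (Phi X) = \tr X.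
Hypothesis Phistar_adj : forall (X : 'M[R[i]]_mA) (Y : 'M[R[i]]_mB),
  \tr (adjmx (Phistar Y) *m X) = \tr (adjmx Y *m Phi X).
Hypothesis Phistar_schwarz : forall rho sigma : 'M[R[i]]_mB, pdmx sigma ->
  loewner (Phistar (adjmx rho) *m invmx (Phistar sigma) *m Phistar rho)
          (Phistar (adjmx rho *m invmx sigma *m rho)).
Local Notation C := R[i].

(** [H] is the difference of the positive matrices [k] and [k - H], whose images are hermitian. *)
Lemma Phi_herm (H : 'M[C]_mA) : adjmx H = H -> adjmx (Phi H) = Phi H.
Proof.
move=> hH; have [k k0 pk] := herm_le_scalar hH.
have h1 := (Phi_pos pk).1; have h2 := (Phi_pos (psdmxZ (ltW k0) (psdmx1 R mA))).1.
have HE : H = k *: 1%:M - (k *: 1%:M - H) by rewrite opprB addrC subrK.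
by rewrite HE linearB adjmxB h1 h2.
Qed.

(** Reduces to [Phi_herm] for the sum of [A] and its adjoint, and for [i] times their difference. *)
Lemma Phi_adjmx (A : 'M[C]_mA) : Phi (adjmx A) = adjmx (Phi A).
Proof.
have h1 : adjmx (Phi A + Phi (adjmx A)) = Phi A + Phi (adjmx A).
  by rewrite -linearD Phi_herm // adjmxD adjmxK addrC.
have h2 : adjmx (Phi A - Phi (adjmx A)) = - (Phi A - Phi (adjmx A)).
  have : adjmx (Phi ('i *: (A - adjmx A))) = Phi ('i *: (A - adjmx A)).
    by apply: Phi_herm; rewrite adjmxZ adjmxB adjmxK conjCi scaleNr -scalerN opprB.
  rewrite linearZ adjmxZ conjCi scaleNr linearB -scalerN => /(scalerI (neq0Ci _)).
  by move=> /(congr1 (@GRing.opp _)); rewrite opprK.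
have two : 2 != 0 :> C by [].
apply/(scalerI two); rewrite !scaler_nat !mulr2n.
rewrite adjmxD in h1; rewrite adjmxB in h2.
apply/matrixP => i j; move/matrixP/(_ i j): h1; move/matrixP/(_ i j): h2.
move: (adjmx (Phi A)) (adjmx (Phi (adjmx A))) (Phi A) (Phi (adjmx A)) => a b c d.
rewrite !mxE => h2 h1.
have -> : d i j + d i j = (c i j + d i j) + - (c i j - d i j) by ring.
by rewrite -h1 -h2; ring.
Qed.

Lemma Phistar_adjr (A : 'M[C]_mA) (Y : 'M[C]_mB) :
  \tr (adjmx (Phi A) *m Y) = \tr (adjmx A *m Phistar Y).
Proof.
rewrite -[in LHS](adjmxK Y) -adjmxM mxtrace_adjmx -Phistar_adj -mxtrace_adjmx.
by rewrite adjmxM adjmxK.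
Qed.

Lemma Phistar_adjmx (Y : 'M[C]_mB) : Phistar (adjmx Y) = adjmx (Phistar Y).
Proof.
apply: trace_adj_inj => W; rewrite -Phistar_adjr -Phi_adjmx mxtrace_mulC -Phistar_adj.
by rewrite mxtrace_mulC.
Qed.

Lemma Phistar_trace (Y : 'M[C]_mB) (A : 'M[C]_mA) : \tr (Phistar Y *m A) = \tr (Y *m Phi A).
Proof. by rewrite -[Y]adjmxK Phistar_adjmx Phistar_adj. Qed.

Lemma Phistar1 : Phistar 1%:M = 1%:M.
Proof.
apply: trace_adj_inj => W; rewrite mxtrace_mulC Phistar_trace mul1mx Phi_tp.
by rewrite mulmx1.
Qed.

(** The form at [v] is the trace of [s] times the image of [v v^*] under [Phi]; trace preservation
    makes this image nonzero, hence the form strictly positive. The inverse in the Schwarz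
    inequality is thus a genuine one. *)
Lemma Phistar_pd (s : 'M[C]_mB) : pdmx s -> pdmx (Phistar s).
Proof.
move=> ps; split; first by rewrite -Phistar_adjmx ps.1.
move=> v v0; have pP : psdmx (Phi (v *m adjmx v)).
  by apply: Phi_pos; have := psdmx_gram (adjmx v); rewrite adjmxK.
have tP : \tr (Phi (v *m adjmx v)) != 0.
  by rewrite Phi_tp mxtrace_mulC trace_mx11 gram_eq0.
have -> : (adjmx v *m Phistar s *m v) 0 0 = \tr (s *m Phi (v *m adjmx v)).
  by rewrite -Phistar_trace -trace_mx11 -mulmxA mxtrace_mulC mulmxA.
have hM := fcalc_herm Num.sqrt (Phi (v *m adjmx v)); have MM := sqrtmxK pP.
move: (fcalc _ _) hM MM tP => M hM <- tM.
rewrite mulmxA mxtrace_mulC mulmxA -{1}hM; apply: pdmx_trace_congr_gt0 => //.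
by apply: contra tM => /eqP->; rewrite mulmx0 linear0.
Qed.

Section Recovery.
Variables (X S : 'M[C]_mA) (G : 'M[C]_mB).
Hypothesis (hS : adjmx S = S) (SS : S *m S = X) (hG : adjmx G = G).
Hypothesis (pG : psdmx (1%:M - G *m Phi X *m G)).

Let pX : psdmx X. Proof. by rewrite -SS -{1}hS; exact: psdmx_gram. Qed.

Lemma recovery_contraction : exists V : 'M[C]_(mA * mA, mB * mB),
  [/\ forall W, adjmx V *m vecm W = vecm (G *m Phi (S *m W)),
      forall rho, V *m vecm rho = vecm (S *m Phistar (G *m rho))
    & psdmx (1%:M - adjmx V *m V)].
Proof.
have [T TE] := super_mx Phi.
(* [V] is built as the adjoint of the matrix of [W] to [G Phi(S W)], using the linearity of [Phi];
   its own formula then follows by duality. *)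
pose V := adjmx ((G *t (1%:M)^T) *m T *m (S *t (1%:M)^T)); exists V.
have aV W : adjmx V *m vecm W = vecm (G *m Phi (S *m W)).
  by rewrite adjmxK -!mulmxA tens_vecm TE tens_vecm !mulmx1.
have VE rho : V *m vecm rho = vecm (S *m Phistar (G *m rho)).
  rewrite -[LHS]unvecmK; congr vecm; apply: trace_adj_inj => W.
  rewrite -vecm_dot unvecmK mulmxA -{1}[V]adjmxK -adjmxM aV vecm_dot adjmxM hG -mulmxA.
  by rewrite Phistar_adjr adjmxM hS mulmxA.
split=> //; split; first by rewrite adjmxB adjmx1 adjmxM adjmxK.
move=> v; rewrite -[v]unvecmK; move: (unvecm v) => {v} rho.
rewrite -/(qform _ _) qformB subr_ge0.
have -> : qform (adjmx V *m V) (vecm rho) =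
    \tr (Phistar (G *m rho) *m Phistar (adjmx rho *m G) *m X).
  rewrite /qform mulmxA -adjmxM -mulmxA VE vecm_dot adjmxM hS -Phistar_adjmx adjmxM hG.
  by rewrite -SS mulmxA -(mulmxA _ S S) mxtrace_mulC !mulmxA.
have -> : qform 1%:M (vecm rho) = \tr (adjmx rho *m rho) by rewrite /qform mulmx1 vecm_dot.
(* Schwarz at [sigma = 1], where [Phistar] is unital, bounds the form by
   [tr (rho^* G Phi(X) G rho)]; then [G Phi(X) G <= 1] finishes. *)
have := Phistar_schwarz (adjmx rho *m G) (pdmx1 R mB).
rewrite adjmxM adjmxK hG Phistar1 invmx1 !mulmx1 invmx1 mulmx1 => /loewner_trace_mul.
move=> /(_ _ pX) /le_trans; apply; rewrite Phistar_trace.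
have := psdmx_trace_ge0 (psdmx_congr rho pG).
rewrite mulmxBr mulmxBl mulmx1 linearB subr_ge0; apply: le_trans.
by rewrite -!mulmxA mxtrace_mulC -!mulmxA mxtrace_mulC -!mulmxA.
Qed.

(** As [T >= S K S] for [K = Phistar (G tau G)], [loewner_compress_inv] gives [S T^-1 S <= K^-1].
    Sandwiched between [Phistar (G rho)] and its adjoint, this meets the Schwarz inequality at
    [sigma = G tau G], where [G sigma^-1 G = tau^-1]. The term [c] makes [T] invertible. *)
Lemma recovery_loewner (tau : 'M[C]_mB) (c : C) (rho : 'M[C]_mB) :
  G \in unitmx -> pdmx tau -> 0 < c ->
  let T := S *m Phistar (G *m tau *m G) *m S + c *: 1%:M in
  loewner (adjmx (S *m Phistar (G *m rho)) *m invmx T *m (S *m Phistar (G *m rho)))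
          (Phistar (adjmx rho *m invmx tau *m rho)).
Proof.
move=> uG ptau c0 T; pose s := G *m tau *m G.
have ps : pdmx s by rewrite /s -{1}hG; exact: pdmx_congr_unit.
have pK := Phistar_pd ps.
have pT : pdmx T.
  rewrite /T addrC; apply: pdmxDl; first exact: pdmxZ (pdmx1 _ _).
  by rewrite -{1}hS; exact: psdmx_congr (pdmx_psd pK).
have le1 : loewner (S *m invmx T *m S) (invmx (Phistar s)).
  apply: loewner_compress_inv => //; rewrite /loewner /T addrC addKr.
  exact: psdmxZ (ltW c0) (psdmx1 _ _).
have := psdmxD (psdmx_congr (Phistar (G *m rho)) le1) (Phistar_schwarz (G *m rho) ps).
rewrite -Phistar_adjmx /loewner; congr psdmx.
rewrite mulmxBr mulmxBl addrC addrA subrK; congr (Phistar _ - _).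
  have sE : G *m invmx s *m G = invmx tau.
    have us := pdmx_unit ps; have ut := pdmx_unit ptau.
    have Gs : G *m invmx s *m G *m tau = 1%:M.
      have := mulVmx us; move: (invmx s) => s' /(congr1 (fun M => G *m M *m invmx G)).
      by rewrite /s !mulmxA mulmx1 mulmxV // mulmxK.
    by rewrite -[LHS](mulmxK ut) Gs mul1mx.
  by rewrite -sE adjmxM hG !mulmxA.
by rewrite (adjmxM S) hS -Phistar_adjmx !mulmxA.
Qed.

End Recovery.
End SchwarzMap.

(** * Removal of the error term and assembly of the monotonicity theorem *)

Lemma le_of_mix (R : realType) (s : \bar R) (q c : R) :
  (forall l, 0 < l -> l < 1 -> exists2 a, (a%:E <= s)%E & q <= (1 - l) * a + l * c) ->
  (q%:E <= s)%E.
Proof.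
case: s => [r| |] H; last 2 first.
- by rewrite leey.
- by have [||a] := H 2^-1; rewrite ?invf_lt1 ?invr_gt0 ?ltr1n // leeNy_eq.
rewrite lee_fin; apply/ler_addgt0Pr => e e0.
(* As [k >= |c - r|], the weight [l = e / (e + k)] makes the error [l (c - r)] at most [e]; this
   choice replaces the limit [l -> 0]. *)
pose k := e + `|c - r|; have k0 : 0 < k by rewrite ltr_pwDl.
have ek0 : 0 < e + k by rewrite addr_gt0.
have l0 : 0 < e / (e + k) by rewrite divr_gt0.
have l1 : e / (e + k) < 1 by rewrite ltr_pdivrMr // mul1r ltrDl.
have [a] := H _ l0 l1; rewrite lee_fin => ar /le_trans; apply.
have l1' : 0 <= 1 - e / (e + k) by rewrite subr_ge0 ltW.
apply: le_trans (lerD (ler_wpM2l l1' ar) (lexx _)) _.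
have -> : (1 - e / (e + k)) * r + e / (e + k) * c = r + e / (e + k) * (c - r) by ring.
rewrite lerD2l mulrAC ler_pdivrMr // ler_pM2l //.
by rewrite (le_trans (ler_norm _)) // /k addrA lerDr addr_ge0 ?ltW.
Qed.

Lemma QtauE (R : realType) (f : R -> R) n (X Z tau : 'M[R[i]]_n) :
  Qtau f X Z tau =
  complex.Re (qform (fcalc f (invmx tau *t Z^T)) (vecm (fcalc Num.sqrt X))).
Proof. by rewrite /Qtau phivecE. Qed.

Lemma Re_realM (R : realType) (x : R) (z : R[i]) : complex.Re (x%:C%C * z) = x * complex.Re z.
Proof. by case: z => a b; simpc. Qed.

Theorem mainTheorem2 (R : realType) (mA mB : nat)
  (Phi : {linear 'M[R[i]]_mA -> 'M[R[i]]_mB})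
  (Phistar : 'M[R[i]]_mB -> 'M[R[i]]_mA)
  (Phi_pos : forall X : 'M[R[i]]_mA, psdmx X -> psdmx (Phi X))
  (Phi_tp : forall X : 'M[R[i]]_mA, \tr (Phi X) = \tr X)
  (Phistar_adj : forall (X : 'M[R[i]]_mA) (Y : 'M[R[i]]_mB),
      \tr (adjmx (Phistar Y) *m X) = \tr (adjmx Y *m Phi X))
  (Phistar_schwarz : forall rho sigma : 'M[R[i]]_mB, pdmx sigma ->
      loewner (Phistar (adjmx rho) *m invmx (Phistar sigma) *m Phistar rho)
              (Phistar (adjmx rho *m invmx sigma *m rho)))
  (f : R -> R) (f_anti : op_anti_monotone f)
  (X Y : 'M[R[i]]_mA) (HX : psdmx X) (HY : psdmx Y) :
  (Qopt f (Phi X) (Phi Y) <= Qopt f X Y)%E.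
Proof.
rewrite {1}/Qopt; apply: ge_ereal_sup => _ [tau [eps [ptau ttau eps0 ->]]].
have pB := Phi_pos _ HX.
have pZB := pdmx_add_kerproj (Phi_pos _ HY) eps0.
have pkB := kerproj_psd (Phi_pos _ HY).
have pkA := kerproj_psd HY; have pE := Phi_pos _ pkA.
set ZB := Phi Y + _ in pZB *.
have [G [hG uG GB pG]] := sqrt_pinv_exists pB.
have hS := fcalc_herm Num.sqrt X; have SS := sqrtmxK HX.
have hSB := fcalc_herm Num.sqrt (Phi X); have SSB := sqrtmxK pB.
rewrite QtauE -GB; rewrite -GB in hSB SSB.
set S := fcalc Num.sqrt X in hS SS *.
have [V [aV VE pV]] := recovery_contraction Phi_pos Phi_tp Phistar_adj Phistar_schwarz hS SS hG pG.
pose D := invmx tau *t ZB^T; have pD : pdmx D := pdmx_tens (pdmx_inv ptau) pZB.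
set u := vecm (G *m Phi X).
(* The error constant depends only on the output data, so it stays fixed while [tauA] and [eps']
   vary with [l]. *)
apply: (le_of_mix (c := complex.Re (qform (fcalc f (2^-1 *: D)) u))) => l l0 l1.
have lC0 : 0 < l%:C%C :> R[i] by rewrite ltcR.
have lC1 : l%:C%C < 1 :> R[i] by rewrite (ltcR l 1).
have [k1 k10 pk1] := herm_le_scalar pE.1.
have [k2 k20 pk2] := pdmx_ge_scalar pZB.
pose n := mA%:R : R[i]; have n0 : 0 <= n by rewrite ler0n.
have d0 : 0 < 4 * (2 * n + 1) by rewrite mulr_gt0 // ltr_wpDl // mulr_ge0.
(* Two losses must fit into [1 + l/4]: [1 + c n] from normalizing the trace of [T], and [1 + c] from
   the regularization of [Y]. For [c <= 1] their product is at most [1 + c (2 n + 1)]. *)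
pose c := l%:C%C / (4 * (2 * n + 1)); have c0 : 0 < c by rewrite divr_gt0.
have cd : c * (2 * n + 1) = l%:C%C / 4.
  by rewrite /c; field; rewrite gt_eqF // ltr_wpDl // mulr_ge0.
have c1 : c <= 1.
  rewrite ler_pdivrMr // mul1r (le_trans (ltW lC1)) // -[leLHS]mulr1 ler_pM ?ler1n //.
  by rewrite lerDr mulr_ge0.
clearbody c.
have cn0 : 0 < 1 + c * n by rewrite ltr_pwDl // mulr_ge0 // ltW.
have cn : (1 + c * n) * (1 + c) <= 1 + l%:C%C / 4.
  rewrite -cd -subr_ge0.
  have -> : 1 + c * (2 * n + 1) - (1 + c * n) * (1 + c) = c * n * (1 - c) by ring.
  by rewrite !mulr_ge0 ?subr_ge0 // ltW.
have e0 : 0 < c * k2 / k1 by rewrite divr_gt0 ?mulr_gt0.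
(* Chosen so that [eps' Phi (kerproj Y) <= eps' k1 = c k2 <= c ZB]. *)
pose eps' := complex.Re (c * k2 / k1).
have epsE : eps'%:C%C = c * k2 / k1 by rewrite RRe_real // gtr0_real.
have eps'0 : 0 < eps' by apply: Re_gt0.
have pZA := pdmx_add_kerproj HY eps'0; set ZA := Y + _ in pZA.
have ZAB : psdmx ((1 + c) *: ZB - Phi ZA).
  have := psdmxD (psdmxD (psdmxZ (ltW c0) pk2) (psdmxZ (ltW e0) pk1))
                 (psdmxZ (ltW (_ : 0 < eps%:C%C)) pkB).
  rewrite ltcR => /(_ eps0); congr psdmx.
  rewrite /ZA [Phi (_ + _)]linearD [Phi (_ *: _)]linearZ /= epsE /ZB.
  move: (kerproj _) (Phi (kerproj _)) => KB KA.
  by apply/matrixP => i j; rewrite !mxE; field; rewrite gt_eqF.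
pose T := S *m Phistar (G *m tau *m G) *m S + c *: 1%:M.
have ps : pdmx (G *m tau *m G) by rewrite -{1}hG; exact: pdmx_congr_unit.
have pK := Phistar_pd Phi_pos Phi_tp Phistar_adj ps.
have pT : pdmx T.
  rewrite /T addrC; apply: pdmxDl; first exact: pdmxZ (pdmx1 _ _).
  by rewrite -{1}hS; exact: psdmx_congr (pdmx_psd pK).
(* By cyclicity and duality the first term has trace [tr (tau G Phi(X) G) <= tr tau <= 1]. *)
have trT : \tr T <= 1 + c * n.
  rewrite /T linearD linearZ /= mxtrace1 lerD2r (le_trans _ ttau) //.
  rewrite mxtrace_mulC mulmxA SS mxtrace_mulC.
  rewrite (Phistar_trace Phi_pos Phistar_adj).
  rewrite -!mulmxA mxtrace_mulC -!mulmxA -subr_ge0.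
  have := psdmx_trace_mul_ge0 (pdmx_psd ptau) pG.
  by rewrite mulmxBr mulmx1 linearB !mulmxA.
pose tauA := (1 + c * n)^-1 *: T.
have ptauA : pdmx tauA by apply: pdmxZ pT; rewrite invr_gt0.
have itauA : invmx tauA = (1 + c * n) *: invmx T.
  by rewrite invmxZ ?invrK //; exact: pdmx_unit ptauA.
exists (Qtau f X ZA tauA).
  apply: ereal_sup_ubound; exists tauA, eps'; split=> //.
  by rewrite linearZ /= mulrC ler_pdivrMr // mul1r.
rewrite QtauE -/S; pose DA := invmx tauA *t ZA^T.
have pDA : pdmx DA := pdmx_tens (pdmx_inv ptauA) pZA.
have Vw : adjmx V *m vecm S = u by rewrite aV SS.
(* The squared norms are [tr (Phi X)] and [tr X]. *)
have uw : adjmx u *m u = adjmx (vecm S) *m vecm S.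
  apply/matrixP => i j; rewrite !ord1 !vecm_dot hSB SSB hS SS; exact: Phi_tp.
have pVD : psdmx ((1 + l%:C%C / 4) *: D - adjmx V *m DA *m V).
  split.
    have l4 : 0 <= 1 + l%:C%C / 4 :> R[i] by rewrite addr_ge0 // divr_ge0 // ltW.
    by rewrite adjmxB (psdmx_congr V (pdmx_psd pDA)).1 (psdmxZ l4 (pdmx_psd pD)).1.
  move=> v; rewrite -[v]unvecmK; move: (unvecm v) => {v} rho.
  rewrite -/(qform _ _) qformB qformZ qform_congr VE !qform_tens subr_ge0.
  rewrite itauA -scalemxAr -!scalemxAl linearZ /=.
  (* Paired with [ZA], the recovery bound moves [Phistar] over to [Phi ZA], which [ZAB] then
     compares with [ZB]. *)
  have le1 := @recovery_loewner _ _ _ _ _ Phi_pos Phi_tp Phistar_adj Phistar_schwarz _ _ hS hG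
    tau c rho uG ptau c0.
  have := loewner_trace_mul le1 (pdmx_psd pZA).
  rewrite (Phistar_trace Phi_pos Phistar_adj) mulmxA => {}le1.
  apply: le_trans (ler_wpM2l (ltW cn0) le1) _.
  have pq := psdmx_congr rho (pdmx_psd (pdmx_inv ptau)).
  have := psdmx_trace_mul_ge0 pq ZAB; rewrite mulmxBr linearB subr_ge0 => le2.
  apply: le_trans (ler_wpM2l (ltW cn0) le2) _.
  rewrite -scalemxAr linearZ /= mulrA ler_wpM2r //.
  exact: psdmx_trace_mul_ge0 pq (pdmx_psd pZB).
have := anti_monotone_contraction_slack f_anti pDA pD lC0 lC1 pV pVD Vw uw.
rewrite lecE => /andP[_]; rewrite raddfD /= -[1 - l%:C%C](rmorphB _ 1 l) !Re_realM.
by [].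
Qed.
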